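(* If there exists an $\mathrm{SCCD}(v,k,b)$ with excess $e$ and an $\mathrm{SCCD}(v',k,b')$ with an outer expansion set and excess $e'$, then an $\mathrm{SCCD}(v^*,k,b^* )$ with $v^*=v+v'-k+1$ and $b^*=b+b'+\frac{(v-k+1)(v'-k+1)}{k-1}$ exists with excess $e^*=e+e'$. Furthermore, if the $\mathrm{SCCD}(v,k,b)$ has an expansion set, then the $\mathrm{SCCD}(v^*,k,b^* )$ has an expansion set.
   Context: An $\mathrm{SCCD}(v,k,b)$ (linear single change covering design) is a $v$-set $X$ with an ordered list $(B_1,\dots,B_b)$ of $k$-subsets of $X$ with $|B_i\cap B_{i+1}|=k-1$ for $1\le i<b$, such that every pair of elements of $X$ is contained in some block. Its excess is $e=(k-1)b+\binom{k-1}{2}-\binom{v}{2}$. The unchanged subsets are $U_i=B_i\cap B_{i+1}$ for $1\le i\le b-1$; in addition $U_0$ may be taken to be any $(k-1)$-subset of $B_1$ and $U_b$ any $(k-1)$-subset of $B_b$. An expansion set is a collection of $\frac{v}{k-1}$ unchanged subsets $U_{i_1},\dots,U_{i_{v/(k-1)}}$ (with distinct indices $i_j\in\{0,\dots,b\}$) that are pairwise disjoint and whose union is $X$. It is an outer expansion set if it contains $U_0$ or $U_b$ (or both), and an inner expansion set otherwise. *)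

(* Defs.v *)
From mathcomp Require Import all_boot all_order all_algebra.

Set Implicit Arguments.
Unset Strict Implicit.
Unset Printing Implicit Defensive.

Import GRing.Theory.

(** Linear single change covering designs.  The blocks B_1, ..., B_b are stored
    in a tuple, hence numbered from 0: [block D i] is B_{i+1}.  The list is
    non-empty, as the end subsets U_0 of B_1 and U_b of B_b presuppose; in
    particular k <= v. *)
Record SCCD (v k b : nat) := MkSCCD {
  point : finType;
  blocks : b.-tuple {set point};
  card_point : #|point| = v;
  blocks_nonempty : 0 < b;
  card_block : forall B : {set point}, B \in blocks -> #|B| = k;
  single_change : forall i : nat, i.+1 < b ->
    #|nth set0 blocks i :&: nth set0 blocks i.+1| = k.-1;
  covering : forall x y : point, x != y ->
    exists2 B : {set point}, B \in blocks & (x \in B) && (y \in B)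
}.

Definition block (v k b : nat) (D : SCCD v k b) (i : nat) : {set point D} :=
  nth set0 (blocks D) i.

Definition excess (v k b : nat) (D : SCCD v k b) : int :=
  ((k.-1 * b)%:Z + 'C(k.-1, 2)%:Z - 'C(v, 2)%:Z)%R.

(** [U] lists U_0, ..., U_b.  The interior ones are determined by the blocks
    (B_i is [block D i.-1]), while U_0 and U_b are free choices. *)
Definition unchanged_subsets (v k b : nat) (D : SCCD v k b)
    (U : 'I_b.+1 -> {set point D}) : Prop :=
  [/\ forall i : 'I_b.+1, 0 < i < b -> U i = block D i.-1 :&: block D i,
      U ord0 \subset block D 0 /\ #|U ord0| = k.-1
    & U ord_max \subset block D b.-1 /\ #|U ord_max| = k.-1].

(** [I] is the set of indices i_1, ..., i_{v/(k-1)}. *)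
Definition expansion_set (v k b : nat) (D : SCCD v k b)
    (U : 'I_b.+1 -> {set point D}) (I : {set 'I_b.+1}) : Prop :=
  [/\ unchanged_subsets U,
      k.-1 %| v /\ #|I| = v %/ k.-1,
      forall i j : 'I_b.+1, i \in I -> j \in I -> i != j ->
        [disjoint U i & U j]
    & \bigcup_(i in I) U i = [set: point D]].

Definition outer_expansion_set (v k b : nat) (D : SCCD v k b)
    (U : 'I_b.+1 -> {set point D}) (I : {set 'I_b.+1}) : Prop :=
  expansion_set U I /\ (ord0 \in I \/ ord_max \in I).

Definition has_expansion_set (v k b : nat) (D : SCCD v k b) : Prop :=
  exists (U : 'I_b.+1 -> {set point D}) (I : {set 'I_b.+1}), expansion_set U I.

Definition has_outer_expansion_set (v k b : nat) (D : SCCD v k b) : Prop :=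
  exists (U : 'I_b.+1 -> {set point D}) (I : {set 'I_b.+1}),
    outer_expansion_set U I.

(* Main.v *)
Require Import Defs.
From mathcomp Require Import all_boot all_order all_algebra.
From mathcomp Require Import zify.
From Stdlib Require Import Classical_Prop.

Set Implicit Arguments.
Unset Strict Implicit.
Unset Printing Implicit Defensive.

(** Identify a (k-1)-subset S of the last block of D (its last unchanged subset
    U_b, if D has an expansion set) with the unchanged subset U'_0 of D', which
    after a reversal may be assumed to belong to the expansion set of D'.  List
    the blocks of D, then those of D'; for every other member U'_j of the
    expansion set of D', insert right after B'_j the blocks U'_j + x, where x
    runs over the v - k + 1 points outside D'.  As the U'_j partition the points
    of D', the inserted blocks cover all the mixed pairs, and the U_i together
    with the U'_j, j <> 0, form an expansion set. *)

(** * Auxiliary facts: binomials, subsets, paths and amalgamated sums of sets *)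

Lemma bin2D (m n : nat) : 'C(m + n, 2) = 'C(m, 2) + 'C(n, 2) + m * n.
Proof.
elim: n => [|n IHn]; first by rewrite addn0 muln0 bin0n !addn0.
by rewrite addnS !binS !bin1 IHn mulnS; lia.
Qed.

Lemma exists_subset_card (T : finType) (A : {set T}) (n : nat) :
  n <= #|A| -> exists2 B : {set T}, B \subset A & #|B| = n.
Proof.
move=> le_nA; exists [set x in take n (enum A)].
  by apply/subsetP=> x; rewrite inE => /mem_take; rewrite mem_enum.
rewrite cardsE; have /card_uniqP-> := take_uniq n (enum_uniq A).
by rewrite size_takel // -cardE.
Qed.

(** Meant for [h i] a block of D' and [t i] the blocks inserted after it. The start [m] and the
    preceding element [x] are free so that the induction on [n] can peel off the first segment. *)
Lemma sorted_flatten_segments (T : Type) (e : rel T) (h : nat -> T)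
    (t : nat -> seq T) (x : T) (m n : nat) :
  e x (h m) ->
  (forall i, m <= i < m + n -> path e (h i) (t i)) ->
  (forall i, m <= i -> i.+1 < m + n -> e (last (h i) (t i)) (h i.+1)) ->
  path e x (flatten [seq h i :: t i | i <- iota m n]).
Proof.
elim: n m x => [|n IHn] m x //= exh pht eth.
rewrite exh cat_path pht ?leqnn ?addnS ?ltnS ?leq_addr //=.
case: n IHn pht eth => [|n] IHn pht eth //.
apply: IHn => [|i /andP[lemi ltin]|i lemi ltin].
- by apply: eth; rewrite // addnS ltnS addnS ltnS leq_addr.
- by apply: pht; rewrite (ltnW lemi) -addSnnS.
- by apply: eth; rewrite ?(ltnW lemi) // -addSnnS.
Qed.

(** The pushout of X and Y along a bijection between B and A, built as the disjoint sum of X and Y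
    minus B. The third and fourth clauses together say that the images of f and g meet exactly in
    the image of A. *)
Lemma amalgam (X Y : finType) (A : {set X}) (B : {set Y}) :
  #|A| = #|B| ->
  exists (T : finType) (f : X -> T) (g : Y -> T),
    [/\ injective f, injective g, f @: A = g @: B,
        forall x y, f x = g y -> y \in B
      & forall t, (exists x, t = f x) \/ (exists y, t = g y)].
Proof.
move=> eqAB.
have [phi [phi_inj phiAB]] : exists phi : {y | y \in B} -> X,
    injective phi /\ (forall x, x \in A <-> exists y, phi y = x).
  (* The bijection matches elements of equal rank in the enumerations of B and A. *)
  have lt_rank (y : {y | y \in B}) : enum_rank_in (valP y) (val y) < #|A|.
    by rewrite eqAB.
  exists (fun y => enum_val (Ordinal (lt_rank y))); split.
    move=> y z /enum_val_inj/(congr1 val)/= eq_yz; apply: val_inj.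
    rewrite -(enum_rankK_in (valP y) (valP y)).
    rewrite -(enum_rankK_in (valP z) (valP z)).
    by congr (enum_val _); apply: val_inj.
  move=> x; split=> [xA|[y <-]]; last exact: enum_valP.
  have lt_r : enum_rank_in xA x < #|B| by rewrite -eqAB.
  exists (exist (fun y => y \in B) _ (enum_valP (Ordinal lt_r))).
  rewrite -[RHS](enum_rankK_in xA xA); congr (enum_val _); apply: val_inj => /=.
  by rewrite enum_valK_in.
pose T : finType := (X + {y : Y | y \notin B})%type.
pose f (x : X) : T := inl x.
(* The value of g on B depends on a membership proof. Packing it with equations valid for every such
   proof spares any later case analysis on how g was built. *)
have gP (y : Y) : {t : T | forall yB : y \in B, t = inl (phi (exist _ y yB))
                         & forall yB : y \notin B, t = inr (exist _ y yB)}.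
  have [yB|yB] : (y \in B) + (y \notin B) by case: (y \in B); [left|right].
    exists (inl (phi (exist _ y yB))) => yB'; last by case/negP: (yB').
    by rewrite (bool_irrelevance yB' yB).
  exists (inr (exist _ y yB)) => yB'; first by case/negP: yB.
  by rewrite (bool_irrelevance yB' yB).
pose g y := s2val (gP y).
have gB y (yB : y \in B) : g y = inl (phi (exist _ y yB)) := s2valP (gP y) yB.
have gN y (yB : y \notin B) : g y = inr (exist _ y yB) := s2valP' (gP y) yB.
exists T, f, g; split.
- by move=> x y [].
- move=> y z; case: (boolP (y \in B)) => yB; case: (boolP (z \in B)) => zB.
  + by rewrite (gB _ yB) (gB _ zB) => -[/phi_inj[]].
  + by rewrite (gB _ yB) (gN _ zB).
  + by rewrite (gN _ yB) (gB _ zB).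
  + by rewrite (gN _ yB) (gN _ zB) => -[].
- apply/setP=> t; apply/imsetP/imsetP=> [[x xA ->]|[y yB ->]].
    have [[y yB] <-] := (phiAB x).1 xA.
    by exists y; rewrite // (gB _ yB).
  rewrite (gB _ yB); exists (phi (exist _ y yB)) => //.
  by apply/phiAB; exists (exist _ y yB).
- move=> x y; case: (boolP (y \in B)) => // yB.
  by rewrite (gN _ yB).
- move=> [x|[y yB]]; first by left; exists x.
  by right; exists y; rewrite (gN _ yB).
Qed.

(** * Unchanged subsets and expansion sets of a single design, and its reversal *)

Section Design.

Context (v k b : nat) (D : SCCD v k b).

Lemma mem_block (i : nat) : i < b -> block D i \in blocks D.
Proof. by move=> ltib; rewrite mem_nth // size_tuple. Qed.

Lemma card_block_nth (i : nat) : i < b -> #|block D i| = k.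
Proof. by move=> ltib; rewrite (card_block (mem_block ltib)). Qed.

Lemma leq_block_size : k <= v.
Proof.
have := max_card (block D 0).
by rewrite (card_block_nth (blocks_nonempty D)) card_point.
Qed.

Section Unchanged.

Context (U : 'I_b.+1 -> {set point D}) (HU : unchanged_subsets U).

Lemma card_unchanged (i : 'I_b.+1) : #|U i| = k.-1.
Proof.
have [Uin [_ U0] [_ Um]] := HU.
have [->//|i0] := eqVneq i ord0; have [->//|im] := eqVneq i ord_max.
have i_gt0 : 0 < i by rewrite lt0n.
have i_ltb : i < b by rewrite ltn_neqAle im -ltnS ltn_ord.
rewrite Uin ?i_gt0 //.
have := @single_change _ _ _ D i.-1; rewrite /block prednK //.
exact.
Qed.

Lemma unchanged_sub_prev (i : 'I_b.+1) : 0 < i -> U i \subset block D i.-1.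
Proof.
move=> i_gt0; have [Uin _ [Um _]] := HU.
have [->//|im] := eqVneq i ord_max.
have i_ltb : i < b by rewrite ltn_neqAle im -ltnS ltn_ord.
by rewrite Uin ?i_gt0 // subsetIl.
Qed.

Lemma unchanged_sub_next (i : 'I_b.+1) : i < b -> U i \subset block D i.
Proof.
move=> i_ltb; have [Uin [U0 _] _] := HU.
have [->//|i0] := eqVneq i ord0.
by rewrite Uin ?i_ltb ?andbT ?lt0n // subsetIr.
Qed.

(** Different indices may carry the same unchanged subset, so one index is picked for each part. As
    all parts have k-1 > 0 elements, the divisibility and the number v/(k-1) of indices follow by
    counting. *)
Lemma has_expansion_set_of_partition (P : {set {set point D}}) :
  1 < k -> partition P [set: point D] ->
  (forall A, A \in P -> exists i, U i = A) -> has_expansion_set D.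
Proof.
move=> k_gt1 Ppart PU.
pose h A := odflt ord0 [pick i | U i == A].
have hK A : A \in P -> U (h A) = A.
  move=> /PU[i UiA]; rewrite /h; case: pickP => [j /eqP//|/(_ i)].
  by rewrite UiA eqxx.
have h_inj : {in P &, injective h}.
  by move=> A B AP BP eqAB; rewrite -(hK _ AP) -(hK _ BP) eqAB.
have cardP : v = #|P| * k.-1.
  transitivity #|[set: point D]|; first by rewrite cardsT card_point.
  apply: card_uniform_partition Ppart.
  by move=> A AP; rewrite -(hK _ AP) card_unchanged.
have [covP triP _] := and3P Ppart.
have k1_gt0 : 0 < k.-1 by lia.
exists U, (h @: P); split=> //.
- split; first by apply/dvdnP; exists #|P|.
  have /(congr1 (divn^~ k.-1))/= -> := cardP.
  by rewrite mulnK // card_in_imset.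
- move=> _ _ /imsetP[A AP ->] /imsetP[B BP ->] neq.
  rewrite !hK //; apply: (trivIsetP triP) => //.
  by apply: contraNneq neq => ->.
- rewrite -(eqP covP) /cover [LHS]big_imset //=.
  by apply: eq_bigr => A AP; rewrite hK.
Qed.

End Unchanged.

(** Recognizes interior unchanged subsets by consecutive blocks, without computing positions. Only
    U_0 is prescribed: in the glued design, U_b of D and the last unchanged subset of D' both become
    interior. *)
Lemma has_expansion_set_of_infix (P : {set {set point D}}) (A0 : {set point D}) :
  1 < k -> A0 \subset block D 0 -> #|A0| = k.-1 -> partition P [set: point D] ->
  (forall A, A \in P -> A = A0 \/
     exists B C, infix [:: B; C] (blocks D) /\ A = B :&: C) ->
  has_expansion_set D.
Proof.
move=> k_gt1 sA0 cA0 Ppart PA.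
have b_gt0 := blocks_nonempty D.
have [Am sAm cAm] : exists2 B : {set point D}, B \subset block D b.-1 & #|B| = k.-1.
  apply: exists_subset_card; rewrite card_block_nth ?leq_pred //.
  by rewrite prednK.
pose U (i : 'I_b.+1) := if i == ord0 then A0 else
  if i == ord_max then Am else block D i.-1 :&: block D i.
have max_neq0 : ord_max == ord0 :> 'I_b.+1 = false.
  by apply/negbTE; rewrite -val_eqE /= -lt0n.
have Uin (i : 'I_b.+1) : 0 < i < b -> U i = block D i.-1 :&: block D i.
  by move=> /andP[i0 ib]; rewrite /U -!val_eqE /= gtn_eqF // ltn_eqF.
have HU : unchanged_subsets U.
  by split; rewrite // /U ?eqxx ?max_neq0.
apply: (has_expansion_set_of_partition HU k_gt1 Ppart) => A /PA[->|].
  by exists ord0; rewrite /U eqxx.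
move=> [B [C [/infixP[s1 [s2 Ds]] ->]]].
have sz : size s1 + (size s2).+2 = b by have := size_tuple (blocks D); rewrite Ds size_cat.
have lt_s1b : (size s1).+1 < b by lia.
(* B has position [size s1], and U_i is the intersection of the blocks at positions i-1 and i. *)
exists (Ordinal (leqW lt_s1b)); rewrite Uin //=.
congr (_ :&: _); first by rewrite /block Ds nth_cat ltnn subnn.
by rewrite /block Ds nth_cat ltnNge leqnSn subSnn.
Qed.

Lemma rev_single_change (i : nat) : i.+1 < b ->
  #|nth set0 (rev_tuple (blocks D)) i :&: nth set0 (rev_tuple (blocks D)) i.+1| = k.-1.
Proof.
move=> ltib; rewrite !nth_rev ?size_tuple ?(ltnW ltib) // setIC.
(* Positions i and i+1 of the reversed list are b-(i+1) and b-(i+2) of the original one. *)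
have := @single_change _ _ _ D (b - i.+2).
by rewrite -subSn // subSS; apply; lia.
Qed.

Lemma rev_card_block (B : {set point D}) : B \in rev_tuple (blocks D) -> #|B| = k.
Proof. by rewrite mem_rev; apply: card_block. Qed.

Lemma rev_covering (x y : point D) : x != y ->
  exists2 B : {set point D}, B \in rev_tuple (blocks D) & (x \in B) && (y \in B).
Proof.
by move=> /covering[B BD xyB]; exists B; rewrite // mem_rev.
Qed.

Definition rev_SCCD : SCCD v k b :=
  MkSCCD (card_point D) (blocks_nonempty D) rev_card_block rev_single_change
    rev_covering.

Lemma block_rev (i : nat) : i < b -> block rev_SCCD i = block D (b - i.+1).
Proof. by move=> ltib; rewrite /block nth_rev ?size_tuple. Qed.

Lemma rev_expansion_set (U : 'I_b.+1 -> {set point D}) (I : {set 'I_b.+1}) :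
  expansion_set U I ->
  expansion_set (D := rev_SCCD) (U \o @rev_ord _) (@rev_ord _ @: I).
Proof.
move=> [[Uin U0 Um] Icard Idisj Icov].
have b_gt0 := blocks_nonempty D.
have rev0 : rev_ord ord0 = ord_max :> 'I_b.+1 by apply: val_inj; rewrite /= subn1.
have revm : rev_ord ord_max = ord0 :> 'I_b.+1 by apply: val_inj; rewrite /= subnn.
split.
- split.
  + move=> i i_in; rewrite [LHS]Uin /=; last by lia.
    rewrite !block_rev; [|lia..].
    by rewrite setIC; congr (block D _ :&: block D _); lia.
  + by rewrite /= rev0 block_rev // subn1.
  + rewrite /= revm block_rev; last by lia.
    by rewrite prednK // subnn.
- by rewrite card_imset //; apply: rev_ord_inj.
- move=> _ _ /imsetP[i iI ->] /imsetP[j jI ->] neq /=.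
  rewrite !rev_ordK; apply: Idisj => //.
  by apply: contraNneq neq => ->.
- rewrite -[RHS]Icov [LHS]big_imset /=; last by move=> i j _ _ /rev_ord_inj.
  by apply: eq_bigr => i _; rewrite rev_ordK.
Qed.

End Design.

Lemma outer_expansion_set_ord0 (v k b : nat) (D : SCCD v k b) :
  has_outer_expansion_set D ->
  exists (D' : SCCD v k b) (U : 'I_b.+1 -> {set point D'}) (I : {set 'I_b.+1}),
    expansion_set U I /\ ord0 \in I.
Proof.
move=> [U [I [UI [I0|Im]]]]; first by exists D, U, I.
exists (rev_SCCD D), (U \o @rev_ord _), (@rev_ord _ @: I).
split; first exact: rev_expansion_set.
by apply/imsetP; exists ord_max => //; apply: val_inj; rewrite /= subnn.
Qed.

Lemma infix_nth2 (T : eqType) (x0 : T) (s : seq T) (i : nat) :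
  i.+1 < size s -> infix [:: nth x0 s i; nth x0 s i.+1] s.
Proof.
move=> ltis; apply/infixP; exists (take i s), (drop i.+2 s).
rewrite -[LHS](cat_take_drop i); congr (_ ++ _).
by rewrite (drop_nth x0) ?(ltnW ltis) // (drop_nth x0).
Qed.

Lemma infix_flatten (T : eqType) (s : seq T) (ss : seq (seq T)) :
  s \in ss -> infix s (flatten ss).
Proof.
by case/splitPr=> s1 s2; rewrite flatten_cat /= infix_infix.
Qed.

(** * The design glued along S and U'_0 *)

Section Gluing.

Context (v v' k b b' : nat) (D : SCCD v k b) (D' : SCCD v' k b').
Context (k_gt1 : 1 < k).
Context (U' : 'I_b'.+1 -> {set point D'}) (I' : {set 'I_b'.+1}).
Context (HU' : expansion_set U' I') (I'0 : ord0 \in I').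
Context (S : {set point D}) (sS : S \subset block D b.-1) (cS : #|S| = k.-1).
Context (T : finType) (f : point D -> T) (g : point D' -> T).
Context (f_inj : injective f) (g_inj : injective g) (fS : f @: S = g @: U' ord0).
Context (fgU : forall x y, f x = g y -> y \in U' ord0).
Context (fgT : forall t, (exists x, t = f x) \/ (exists y, t = g y)).

Let unchU' : unchanged_subsets U'. Proof. by case: HU'. Qed.

Definition gblock (i : nat) : {set T} := g @: block D' i.

(** For [i < b'] the index [i.+1] runs over 1, ..., b', so U'_0 never receives inserted blocks: its
    points are identified with those of S, and D covers their pairs with the new points. *)
Definition gunchanged (i : nat) : {set T} := g @: U' (inord i.+1).

Definition new_points : seq T := enum (~: (g @: [set: point D'])).

(* [U'_(i+1)] lies in the blocks numbered [i] and [i + 1], so that it may be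
   completed by each new point in turn between these two blocks. *)
Definition inserted (i : nat) : seq {set T} :=
  if inord i.+1 \in I' then [seq x |: gunchanged i | x <- new_points] else [::].

Definition glued_blocks : seq {set T} :=
  [seq f @: B | B : {set point D} <- blocks D] ++
  flatten [seq gblock i :: inserted i | i <- iota 0 b'].

(** By [fgU], a point [f x] in the image of g comes from U'_0, hence lies in [f @: S], and x is in S
    by injectivity. *)
Lemma mem_new_points (t : T) :
  reflect (exists2 x, x \notin S & t = f x) (t \in new_points).
Proof.
rewrite mem_enum in_setC; apply: (iffP idP) => [tg|[x xS ->]].
  case: (fgT t) => [[x tx]|[y ty]]; last by rewrite ty imset_f in tg.
  exists x => //; apply: contra tg => xS.
  have : t \in g @: U' ord0 by rewrite -fS tx imset_f.
  by apply/subsetP/imsetS/subsetT.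
apply: contra xS => /imsetP[y _ fxy].
have : f x \in f @: S by rewrite fS fxy imset_f // (fgU fxy).
by rewrite mem_imset.
Qed.

Lemma new_pointsN (y : point D') : g y \notin new_points.
Proof. by rewrite mem_enum in_setC negbK imset_f. Qed.

Lemma card_glued : #|T| = v + v' - k + 1.
Proof.
rewrite -cardsT; have := cardsUI (f @: [set: point D]) (g @: [set: point D']).
have -> : f @: [set: point D] :&: g @: [set: point D'] = f @: S.
  apply/setP=> t; rewrite inE; apply/andP/idP=> [[/imsetP[x _ ->]]|tS].
    by case/imsetP=> y _ fxy; rewrite fS fxy imset_f // (fgU fxy).
  split; first by apply: subsetP tS; apply/imsetS/subsetT.
  by move: tS; rewrite fS; apply/subsetP/imsetS/subsetT.
have -> : f @: [set: point D] :|: g @: [set: point D'] = [set: T].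
  by apply/setP=> t; rewrite !inE; case: (fgT t) => -[x ->]; rewrite imset_f ?orbT.
rewrite !card_imset // (cardsT (point D)) (cardsT (point D')) !card_point cS.
by have := leq_block_size D; lia.
Qed.

Lemma size_new_points : size new_points = v - k + 1.
Proof.
rewrite -cardE; have := cardsC (g @: [set: point D']).
rewrite card_glued card_imset // cardsT card_point.
by have := leq_block_size D; have := leq_block_size D'; lia.
Qed.

Lemma card_gunchanged (i : nat) : #|gunchanged i| = k.-1.
Proof. by rewrite card_imset // (card_unchanged unchU'). Qed.

Lemma card_extend_gunchanged (i : nat) (x : T) : x \in new_points ->
  #|x |: gunchanged i| = k.
Proof.
move=> xnew; rewrite cardsU1 card_gunchanged.
suff -> : x \notin gunchanged i by rewrite add1n prednK // ltnW.
by apply: contraL xnew => /imsetP[y _ ->]; apply: new_pointsN.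
Qed.

Lemma gunchanged_sub (i : nat) : i < b' -> gunchanged i \subset gblock i.
Proof.
move=> ltib; apply: imsetS.
by have := @unchanged_sub_prev _ _ _ _ _ unchU' (inord i.+1); rewrite inordK //; apply.
Qed.

Lemma gunchanged_subS (i : nat) : i.+1 < b' -> gunchanged i \subset gblock i.+1.
Proof.
move=> ltib; apply: imsetS.
have := @unchanged_sub_next _ _ _ _ _ unchU' (inord i.+1).
by rewrite inordK ?(leqW ltib) //; apply.
Qed.

(** Stated for any V because [gunchanged i] is compared both with the block before the inserted ones
    and with the block after them. *)
Lemma extend_gblockI (V : {set T}) (i : nat) (x : T) :
  V \subset gblock i -> x \in new_points -> (x |: V) :&: gblock i = V.
Proof.
move=> sVi xnew; rewrite setIUl (setIidPl sVi); apply/setUidPr.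
apply/subsetP=> y; rewrite !inE => /andP[/eqP-> /imsetP[z _ xz]].
by rewrite xz (negbTE (new_pointsN z)) in xnew.
Qed.

Lemma extend_gunchangedI (i : nat) (x y : T) :
  x \in new_points -> x != y ->
  (x |: gunchanged i) :&: (y |: gunchanged i) = gunchanged i.
Proof.
move=> xnew neq; rewrite -setUIl; apply/setUidPr/subsetP=> z.
by rewrite !inE => /andP[/eqP-> xy]; rewrite xy in neq.
Qed.

Definition adjacent : rel {set T} := fun A B => #|A :&: B| == k.-1.

(** Any two blocks of the segment, not just neighbours, meet exactly in [gunchanged i]; so the new
    points may be taken in any order. *)
Lemma path_segment (i : nat) : i < b' -> path adjacent (gblock i) (inserted i).
Proof.
move=> ltib; rewrite /inserted; case: ifP => // _.
have adj_new (s : seq T) : uniq s -> {subset s <= new_points} ->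
    pairwise adjacent [seq x |: gunchanged i | x <- s].
  elim: s => //= x s IHs /andP[xs us] sub.
  rewrite IHs ?andbT //; last by move=> y ys; apply: sub; rewrite inE ys orbT.
  apply/allP=> _ /mapP[y ys ->]; rewrite /adjacent.
  rewrite extend_gunchangedI ?card_gunchanged //; first by rewrite sub ?mem_head.
  by apply: contraNneq xs => ->.
apply: (@pairwise_sorted _ adjacent (gblock i :: _)) => /=.
rewrite adj_new ?enum_uniq // andbT; apply/allP=> _ /mapP[x xnew ->].
rewrite /adjacent setIC extend_gblockI ?card_gunchanged //.
exact: gunchanged_sub.
Qed.

Lemma adjacent_segments (i : nat) : i.+1 < b' ->
  adjacent (last (gblock i) (inserted i)) (gblock i.+1).
Proof.
move=> ltib.
have adj0 : adjacent (gblock i) (gblock i.+1).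
  rewrite /adjacent -imsetI; last by move=> ? ? _ _ /g_inj.
  by rewrite card_imset //; apply/eqP/single_change.
(* The last block of the segment is either its head, where the single change of D' applies, or some
   inserted block, whose subset U'_(i+1) also lies in the next block of D'. *)
have := mem_last (gblock i) (inserted i); rewrite inE => /orP[/eqP-> //|].
rewrite [X in _ \in X]/inserted; case: ifP => [_ /mapP[x xnew ->]|//].
by rewrite /adjacent extend_gblockI ?card_gunchanged ?gunchanged_subS.
Qed.

Lemma nth_glued_blocks (i : nat) : i < b ->
  nth set0 glued_blocks i = f @: block D i.
Proof.
move=> ltib; rewrite nth_cat size_map size_tuple ltib.
by rewrite (nth_map set0) ?size_tuple.
Qed.

Lemma nth_glued_blocks_b : nth set0 glued_blocks b = gblock 0.
Proof.
rewrite nth_cat size_map size_tuple ltnn subnn.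
by rewrite -(prednK (blocks_nonempty D')).
Qed.

(** The images of the two point sets meet exactly in that of S, which is also that of U'_0, and this
    lies both in the last block of D and in the first block of D'. *)
Lemma glued_junction : f @: block D b.-1 :&: gblock 0 = f @: S.
Proof.
apply/setP=> t; rewrite inE; apply/andP/idP=> [[/imsetP[x _ ->]]|tS].
  by case/imsetP=> y _ fxy; rewrite fS fxy imset_f // (fgU fxy).
split; first by apply: subsetP tS; apply: imsetS.
move: tS; rewrite fS; apply/subsetP/imsetS.
exact: (unchanged_sub_next unchU' (blocks_nonempty D' : @ord0 b' < b')).
Qed.

Lemma sorted_glued_blocks : sorted adjacent glued_blocks.
Proof.
rewrite /glued_blocks.
have szs : size [seq f @: B | B : {set point D} <- blocks D] = b.
  by rewrite size_map size_tuple.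
have sorted_s : sorted adjacent [seq f @: B | B : {set point D} <- blocks D].
  apply/(sortedP set0) => i; rewrite szs => ltib.
  rewrite !(nth_map set0) ?size_tuple ?(ltnW ltib) // /adjacent.
  rewrite -imsetI; last by move=> ? ? _ _ /f_inj.
  by rewrite card_imset //; apply/eqP/single_change.
have last_s : nth set0 [seq f @: B | B : {set point D} <- blocks D] b.-1 =
    f @: block D b.-1.
  by rewrite (nth_map set0) // size_tuple ltn_predL (blocks_nonempty D).
(* Exposing the head of the first list turns sortedness of the concatenation into a path; the empty
   case contradicts b > 0. *)
case: [seq _ | B <- _] szs sorted_s last_s => [|B s] /= szs sorted_s last_s.
  by have := blocks_nonempty D; rewrite -szs.
rewrite cat_path sorted_s /=; apply: sorted_flatten_segments.
- rewrite (last_nth set0) -[size s]/((size s).+1.-1) szs last_s.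
  by rewrite /adjacent glued_junction card_imset // cS.
- by move=> i /= ltib; apply: path_segment.
- by move=> i _; apply: adjacent_segments.
Qed.

(** With q = v'/(k-1) members in the expansion set, all but U'_0 receive v-k+1 blocks. Since v'-k+1
    = (q-1)(k-1), the division is exact and yields (q-1)(v-k+1). *)
Lemma size_glued_blocks :
  size glued_blocks = b + b' + ((v - k + 1) * (v' - k + 1)) %/ (k - 1).
Proof.
have [_ [dv' cI'] _ _] := HU'.
rewrite size_cat size_map size_tuple -addnA; congr (_ + _).
have -> : iota 0 b' = index_iota 0 b' by rewrite /index_iota subn0.
rewrite size_flatten sumnE big_map big_map big_mkord /=.
under eq_bigr => i _ do rewrite -addn1 addnC /inserted.
rewrite big_split /= sum1_card card_ord; congr (_ + _).
have size_ins (i : 'I_b') : size (inserted i) =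
    if lift ord0 i \in I' then v - k + 1 else 0.
  have -> : lift ord0 i = inord i.+1.
    by apply: val_inj; rewrite /= inordK // ltnS ltn_ord.
  by rewrite /inserted; case: ifP => // _; rewrite size_map size_new_points.
under eq_bigr => i _ do rewrite size_ins.
(* The separate summand v-k+1 is the share of [ord0]; the other indices have the form [lift ord0 i],
   that is, i+1. *)
have : #|I'| * (v - k + 1) =
    v - k + 1 + \sum_(i < b') (if lift ord0 i \in I' then v - k + 1 else 0).
  by rewrite -sum_nat_const big_mkcond big_ord_recl I'0.
have [q v'q] := dvdnP dv'.
have -> : #|I'| = q by rewrite cI' v'q mulnK //; lia.
have kv' := leq_block_size D'.
have q_gt0 : 0 < q by case: (q) v'q => //; lia.
have -> : v' - k + 1 = q.-1 * (k - 1) by nia.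
rewrite mulnA mulnK; last by lia.
by rewrite -{1}(prednK q_gt0) mulSn => /addnI <-; rewrite mulnC.
Qed.

Lemma mem_glued_blocksP (A : {set T}) :
  reflect [\/ exists2 B, B \in blocks D & A = f @: B,
              exists2 i, i < b' & A = gblock i
            | exists i x, [/\ i < b', inord i.+1 \in I', x \in new_points
                            & A = x |: gunchanged i]]
    (A \in glued_blocks).
Proof.
rewrite mem_cat; apply: (iffP orP) => [[/mapP[B BD ->]|]|].
- by apply: Or31; exists B.
- case/flattenP=> _ /mapP[i + ->]; rewrite mem_iota => /= ltib.
  rewrite inE => /orP[/eqP->|]; first by apply: Or32; exists i.
  rewrite /inserted; case: ifP => // iI /mapP[x xnew ->].
  by apply: Or33; exists i, x.
- case=> [[B BD ->]|[i ltib ->]|[i [x [ltib iI xnew ->]]]].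
  + by left; apply: map_f.
  + right; apply/flattenP; exists (gblock i :: inserted i); last exact: mem_head.
    by apply/mapP; exists i; rewrite // mem_iota.
  + right; apply/flattenP; exists (gblock i :: inserted i).
      by apply/mapP; exists i; rewrite // mem_iota.
    by rewrite inE /inserted iI; apply/orP; right; apply: map_f.
Qed.

Lemma card_glued_block (A : {set T}) : A \in glued_blocks -> #|A| = k.
Proof.
case/mem_glued_blocksP=> [[B BD ->]|[i ltib ->]|[i [x [_ _ xnew ->]]]].
- by rewrite card_imset // (card_block BD).
- by rewrite card_imset // card_block_nth.
- exact: card_extend_gunchanged.
Qed.

Lemma cover_mixed_pair (x : point D) (t : T) : f x \in new_points ->
  t \notin new_points -> f x != t ->
  exists2 A, A \in glued_blocks & (f x \in A) && (t \in A).
Proof.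
move=> xnew told neq; have [_ _ _ I'cov] := HU'.
case: (fgT t) => [[z tz]|[y ty]].
  have [B BD xzB] : exists2 B, B \in blocks D & (x \in B) && (z \in B).
    by apply: covering; apply: contraNneq neq => ->; rewrite tz.
  exists (f @: B); first by apply/mem_glued_blocksP/Or31; exists B.
  by rewrite tz !mem_imset.
have /bigcupP[i iI yi] : y \in \bigcup_(i in I') U' i by rewrite I'cov.
(* If t lies in the image of U'_0, it is a point of D after all and D covers the pair; otherwise the
   block inserted for [f x] at U'_i does. *)
have [i0|i0] := eqVneq i ord0.
  have : t \in f @: S by rewrite fS ty -i0 imset_f.
  case/imsetP=> z zS tz.
  have [B BD xzB] : exists2 B, B \in blocks D & (x \in B) && (z \in B).
    by apply: covering; apply: contraNneq neq => ->; rewrite tz.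
  exists (f @: B); first by apply/mem_glued_blocksP/Or31; exists B.
  by rewrite tz !mem_imset.
have i_gt0 : 0 < i by rewrite lt0n.
have eqi : inord i.-1.+1 = i by rewrite prednK // inord_val.
exists (f x |: gunchanged i.-1).
  apply/mem_glued_blocksP/Or33; exists i.-1, (f x); rewrite eqi; split=> //.
  by rewrite -ltnS prednK.
by rewrite setU11 ty !inE /gunchanged eqi imset_f ?orbT.
Qed.

Lemma covering_glued (s t : T) : s != t ->
  exists2 A, A \in glued_blocks & (s \in A) && (t \in A).
Proof.
move=> neq.
have [|sold] := boolP (s \in new_points).
  case/mem_new_points=> x xS sx; rewrite sx in neq *.
  have xnew : f x \in new_points by apply/mem_new_points; exists x.
  have [|told] := boolP (t \in new_points); last exact: cover_mixed_pair.
  case/mem_new_points=> z _ tz.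
  have [B BD xzB] : exists2 B, B \in blocks D & (x \in B) && (z \in B).
    by apply: covering; apply: contraNneq neq => ->; rewrite tz.
  exists (f @: B); first by apply/mem_glued_blocksP/Or31; exists B.
  by rewrite tz !mem_imset.
have [|told] := boolP (t \in new_points).
  case/mem_new_points=> x xS tx; rewrite tx in neq *.
  have xnew : f x \in new_points by apply/mem_new_points; exists x.
  rewrite eq_sym in neq.
  have [A AL xsA] := cover_mixed_pair xnew sold neq.
  by exists A; rewrite // andbC.
have old (u : T) : u \notin new_points -> exists y, u = g y.
  by rewrite mem_enum in_setC negbK => /imsetP[y _ ->]; exists y.
have [y sy] := old _ sold; have [z tz] := old _ told.
have [B BD yzB] : exists2 B, B \in blocks D' & (y \in B) && (z \in B).
  by apply: covering; apply: contraNneq neq => yz; rewrite sy tz yz.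
exists (g @: B); last by rewrite sy tz !mem_imset.
apply/mem_glued_blocksP/Or32; exists (index B (blocks D')).
  by rewrite -[X in _ < X](size_tuple (blocks D')) index_mem.
by rewrite /gblock /block nth_index.
Qed.

Lemma single_change_glued (i : nat) : i.+1 < size glued_blocks ->
  #|nth set0 glued_blocks i :&: nth set0 glued_blocks i.+1| = k.-1.
Proof. by move=> lti; apply/eqP/(sortedP _ sorted_glued_blocks). Qed.

(** Ensures that position [b], the first block of D', exists as right neighbour of the last block of
    D. *)
Lemma size_glued_blocks_gt : b < size glued_blocks.
Proof.
rewrite size_glued_blocks -addnA -[X in X < _]addn0 ltn_add2l.
by rewrite addn_gt0 (blocks_nonempty D').
Qed.

(** * The expansion set of the glued design *)

Section Partition.

Context (U : 'I_b.+1 -> {set point D}) (I : {set 'I_b.+1}).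
Context (HU : expansion_set U I) (US : U ord_max = S).

(** [ord0] is removed because U'_0 is identified with S, whose points the U_i already cover. *)
Definition glued_partition : {set {set T}} :=
  [set f @: U i | i in I] :|: [set g @: U' i | i in I' :\ ord0].

(** An interior U_i stays between the same two blocks, U_b = S appears at the junction of D and D',
    and U'_j with j > 0 appears between B'_j and the first block inserted after it. *)
Lemma infix_glued_partition (A : {set T}) : A \in glued_partition ->
  A = f @: U ord0 \/
  exists B C, infix [:: B; C] glued_blocks /\ A = B :&: C.
Proof.
have [[Uin _ _] _ _ _] := HU.
have ltbL := size_glued_blocks_gt.
rewrite inE => /orP[/imsetP[i iI ->]|/imsetP[i]].
  have [->|i0] := eqVneq i ord0; [by left | right].
  have i_gt0 : 0 < i by rewrite lt0n.
  have leib : i <= b by rewrite -ltnS.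
  exists (nth set0 glued_blocks i.-1), (nth set0 glued_blocks i); split.
    rewrite -[X in [:: _; nth _ _ X]](prednK i_gt0); apply: infix_nth2.
    by rewrite prednK // (leq_ltn_trans leib).
  rewrite nth_glued_blocks; last by rewrite prednK.
  have [im|im] := eqVneq i ord_max.
    by rewrite im US nth_glued_blocks_b glued_junction.
  have ltib : i < b by rewrite ltn_neqAle im.
  rewrite nth_glued_blocks // Uin ?i_gt0 // imsetI // => ? ? _ _.
  exact: f_inj.
rewrite !inE => /andP[i0 iI]; right.
have i_gt0 : 0 < i by rewrite lt0n.
have eqi : inord i.-1.+1 = i by rewrite prednK // inord_val.
have ltib : i.-1 < b' by rewrite -ltnS prednK.
(* Some block is inserted after B'_j, as there are v-k+1 > 0 new points. *)
have [x [s Ds]] : exists x s, new_points = x :: s.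
  case: new_points size_new_points => [|x s _]; first by rewrite addn1.
  by exists x, s.
have xnew : x \in new_points by rewrite Ds mem_head.
exists (gblock i.-1), (x |: gunchanged i.-1); split.
  apply/infix_catl/(@infix_trans _ (gblock i.-1 :: inserted i.-1)).
    rewrite /inserted eqi iI Ds /=.
    exact: (prefix_infix [:: _; _]).
  by apply/infix_flatten/mapP; exists i.-1; rewrite // mem_iota.
rewrite setIC extend_gblockI ?gunchanged_sub //.
by rewrite /gunchanged eqi.
Qed.

Lemma partition_glued_partition : partition glued_partition [set: T].
Proof.
have [unchU _ Idisj Icov] := HU; have [_ _ I'disj I'cov] := HU'.
have disj_imset (X : finType) (h : X -> T) (A B : {set X}) : injective h ->
    [disjoint A & B] -> [disjoint h @: A & h @: B].
  move=> h_inj; rewrite -!setI_eq0 -imsetI; last by move=> ? ? _ _ /h_inj.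
  by move=> /eqP->; rewrite imset0.
(* A common point would come from U'_0, which is disjoint from every other member of the expansion
   set of D'. *)
have disj_fg (i : 'I_b.+1) (j : 'I_b'.+1) : j \in I' :\ ord0 ->
    [disjoint f @: U i & g @: U' j].
  rewrite !inE => /andP[j0 jI]; rewrite disjoints_subset.
  apply/subsetP=> _ /imsetP[x _ ->]; rewrite inE.
  apply/imsetP=> -[y yj /fgU y0].
  by have /disjointFr/(_ yj) := I'disj _ _ jI I'0 j0; rewrite y0.
apply/and3P; split.
- apply/eqP/setP=> t; rewrite inE; apply/bigcupP.
  have cover_f x : exists2 A, A \in glued_partition & f x \in A.
    have /bigcupP[i iI xi] : x \in \bigcup_(i in I) U i by rewrite Icov.
    by exists (f @: U i); rewrite ?imset_f // inE imset_f.
  case: (fgT t) => [[x ->]|[y ->]]; first exact: cover_f.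
  have /bigcupP[i iI yi] : y \in \bigcup_(i in I') U' i by rewrite I'cov.
  have [i0|i0] := eqVneq i ord0.
    have : g y \in f @: S by rewrite fS -i0 imset_f.
    by case/imsetP=> x _ ->; apply: cover_f.
  exists (g @: U' i); last exact: imset_f.
  by rewrite inE; apply/orP; right; apply: imset_f; rewrite !inE i0.
- apply/trivIsetP=> A B; rewrite !inE.
  case/orP=> /imsetP[i iI ->]; case/orP=> /imsetP[j jI ->] neq.
  + by apply/disj_imset/Idisj => //; apply: contraNneq neq => ->.
  + exact: disj_fg.
  + by rewrite disjoint_sym disj_fg.
  + move: iI jI; rewrite !inE => /andP[_ iI] /andP[_ jI].
    by apply/disj_imset/I'disj => //; apply: contraNneq neq => ->.
(* No part is empty, since each has k-1 > 0 elements. *)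
- apply/negP; rewrite inE => /orP[] /imsetP[i _ /(congr1 (fun A => #|pred_of_set A|))].
    by rewrite cards0 card_imset // (card_unchanged unchU); lia.
  by rewrite cards0 card_imset // (card_unchanged unchU'); lia.
Qed.

End Partition.

End Gluing.

(* The design depends on [S] only, but its expansion set needs [S] to be the
   last unchanged subset of that of [D]. *)
Lemma glue_SCCD (v v' k b b' : nat) (D : SCCD v k b) (D' : SCCD v' k b')
    (U' : 'I_b'.+1 -> {set point D'}) (I' : {set 'I_b'.+1}) (S : {set point D}) :
  1 < k -> expansion_set U' I' -> ord0 \in I' ->
  S \subset block D b.-1 -> #|S| = k.-1 ->
  exists Ds : SCCD (v + v' - k + 1) k
                (b + b' + ((v - k + 1) * (v' - k + 1)) %/ (k - 1)),
    forall U I, expansion_set (D := D) U I -> U ord_max = S ->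
      has_expansion_set Ds.
Proof.
move=> k_gt1 HU' I'0 sS cS.
have [unchU' _ _ _] := HU'.
have [|T [f [g [f_inj g_inj fS fgU fgT]]]] := @amalgam _ _ S (U' ord0).
  by rewrite cS (card_unchanged unchU').
pose L := glued_blocks U' I' f g.
have szL : size L = _ := size_glued_blocks k_gt1 HU' I'0 sS cS f_inj g_inj fS fgU fgT.
have b_gt0 : 0 < b + b' + ((v - k + 1) * (v' - k + 1)) %/ (k - 1).
  by rewrite -addnA addn_gt0 (blocks_nonempty D).
have scL i : i.+1 < b + b' + ((v - k + 1) * (v' - k + 1)) %/ (k - 1) ->
    #|nth set0 L i :&: nth set0 L i.+1| = k.-1.
  by rewrite -szL; apply: (single_change_glued HU' sS cS).
pose Ds := @MkSCCD _ k _ T (Tuple (introT eqP szL))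
  (card_glued k_gt1 I'0 sS cS f_inj g_inj fS fgU fgT) b_gt0
  (card_glued_block k_gt1 HU' f_inj g_inj) scL
  (covering_glued HU' f_inj g_inj fS fgU fgT).
exists Ds => U I HU US; have [unchU _ _ _] := HU.
apply: (@has_expansion_set_of_infix _ _ _ Ds (glued_partition U' I' f g U I)
  (f @: U ord0)) => //.
- rewrite /block /= nth_glued_blocks ?(blocks_nonempty D) //.
  exact/imsetS/(unchanged_sub_next unchU (blocks_nonempty D : @ord0 b < b)).
- by rewrite card_imset // (card_unchanged unchU).
- exact: (partition_glued_partition k_gt1 HU' I'0 sS cS).
- by move=> A; apply: (infix_glued_partition k_gt1 HU' I'0 sS cS _ _ fS _ fgT HU US).
Qed.

(** * Choice of S and additivity of the excess *)

Theorem theorem3 (v v' k b b' : nat) (e e' : int) (hk : 2 <= k)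
    (D : SCCD v k b) (he : excess D = e)
    (D' : SCCD v' k b') (he' : excess D' = e')
    (hD' : has_outer_expansion_set D') :
  exists Ds : SCCD (v + v' - k + 1) k
                (b + b' + ((v - k + 1) * (v' - k + 1)) %/ (k - 1)),
    excess Ds = (e + e')%R /\
    (has_expansion_set D -> has_expansion_set Ds).
Proof.
have [D1 [U' [I' [HU' I'0]]]] := outer_expansion_set_ord0 hD'.
(* One design must serve both claims, so S is fixed beforehand: U_b of an expansion set of D if
   there is one, any (k-1)-subset of the last block otherwise. *)
have [S [sS cS US]] : exists S : {set point D},
    [/\ S \subset block D b.-1, #|S| = k.-1
      & has_expansion_set D -> exists U I, expansion_set (D := D) U I /\ U ord_max = S].
  have [[U [I HU]]|noU] := classic (has_expansion_set D).
    have [[_ _ [sU cU]] _ _ _] := HU.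
    by exists (U ord_max); split=> // _; exists U, I.
  have [|S sS cS] := @exists_subset_card _ (block D b.-1) k.-1.
    by rewrite card_block_nth ?leq_pred // ltn_predL (blocks_nonempty D).
  by exists S; split.
have [Ds HDs] := glue_SCCD hk HU' I'0 sS cS.
exists Ds; split; last by move=> /US[U [I [HU Um]]]; apply: HDs HU Um.
rewrite -he -he' /excess.
have [_ [dv' _] _ _] := HU'.
have kv := leq_block_size D; have kv' := leq_block_size D'.
(* As k-1 divides v', it divides v'-(k-1), so the quotient q in b* is exact. *)
have dvc : k - 1 %| v' - k + 1.
  rewrite subn1; have -> : v' - k + 1 = v' - k.-1 by lia.
  exact: dvdn_sub.
have := divnK (dvdn_mull (v - k + 1) dvc).
move: (_ %/ _) => q; have -> : k - 1 = k.-1 by lia.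
(* In terms of m = k-1, a = v-m and c = v'-m, one has v* = a+c+m and qm = ac. The mixed term ac in
   the binomial of v* cancels against the contribution mq of the inserted blocks. *)
have [m km] : exists m, k = m.+1 by exists k.-1; lia.
have [a va] : exists a, v = a + m by exists (v - m); lia.
have [c vc] : exists c, v' = c + m by exists (v' - m); lia.
have -> : v + v' - k + 1 = a + c + m by lia.
have -> : v - k + 1 = a by lia.
have -> : v' - k + 1 = c by lia.
rewrite va vc km /= !bin2D => qm.
rewrite !mulnDl !mulnDr [m * q]mulnC qm; lia.
Qed.
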